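(* Let $m\geqslant 3$ be an integer, and let $L\subset\mathbb{P}^2$ be a reduced line arrangement (over $\mathbb{C}$) of degree $d$ with irreducible components $L_1,\dots,L_d$, where $\tfrac dm\in\mathbb{Z}$. Assume that the $m$-complexity of $L$ satisfies $$C_{L,m}\leqslant\lceil m/2\rceil .$$ Then there is a subset $J\subset\{1,\dots,d\}$ with $|J|=\tfrac dm$ such that, with $L_J:=\bigcup_{i\in J}L_i$, $$L^{[\geqslant 3]}\cap L^{[km]}\subset L_J^{[\geqslant k]}\qquad\text{for all integers }k\geqslant 1.$$
   Context: For a union $Z\subset\mathbb{P}^2$ of distinct lines and $P\in Z$, $\mathrm{mult}_PZ$ is the number of lines of $Z$ through $P$. For an integer $k>0$: $Z^{[k]}:=\{P\in Z\mid \mathrm{mult}_PZ=k\}$, $Z^{[\geqslant k]}:=\{P\in Z\mid \mathrm{mult}_PZ\geqslant k\}$, $Z^{[(k)]}:=\{P\in Z\mid \mathrm{mult}_PZ\in k\mathbb{Z}\}$. This is applied to $Z=L$ and $Z=L_J$. The $m$-complexity of $L$ (for $m\geqslant 3$) is $C_{L,m}:=\max_P n_P$, where $P$ runs over the points of $L^{[(m)]}$ and $n_P$ is the number of lines in $L$ containing $P$ and another point of $L^{[(m)]}$ (the maximum over the empty set is taken to be $0$). *)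

(* Defs.v *)
From HB Require Import structures.
From mathcomp Require Import all_boot all_order all_algebra.
From mathcomp Require Import all_classical all_reals.
From mathcomp.real_closed Require Export complex.

Set Implicit Arguments.
Unset Strict Implicit.
Unset Printing Implicit Defensive.

Import GRing.Theory.
Local Open Scope ring_scope.
Local Open Scope classical_set_scope.

(* Points and lines of P^2(K) are the 1- and 2-dimensional linear subspaces of
   K^3. *)
Definition proj_point (K : fieldType) :=
  {U : {vspace 'rV[K]_3} | \dim U == 1%N}.

Definition proj_line (K : fieldType) :=
  {U : {vspace 'rV[K]_3} | \dim U == 2%N}.

Definition on_line (K : fieldType) (P : proj_point K) (l : proj_line K) : bool :=
  (val P <= val l)%VS.

(* A reduced arrangement of d lines is an injective family
   L : 'I_d -> proj_line K.  The sub-arrangement L_J is given by L and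
   J : {set 'I_d}, and L itself by J = [set: 'I_d]. *)
Section Arrangement.
Variables (K : fieldType) (d : nat) (L : 'I_d -> proj_line K).
Implicit Types (J : {set 'I_d}) (P Q : proj_point K) (k m : nat).

Definition lines_union J : set (proj_point K) :=
  [set P | exists2 i, i \in J & on_line P (L i)].

Definition mult J P : nat := #|[pred i in J | on_line P (L i)]|.

Definition mult_eq J k : set (proj_point K) :=
  [set P | lines_union J P /\ mult J P = k].

Definition mult_ge J k : set (proj_point K) :=
  [set P | lines_union J P /\ (k <= mult J P)%N].

Definition mult_dvd J k : set (proj_point K) :=
  [set P | lines_union J P /\ (k %| mult J P)%N].

Definition busy_lines m P : nat :=
  #|[pred i | on_line P (L i) &
      `[< exists Q, [/\ Q != P, mult_dvd [set: 'I_d]%SET m Q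
                      & on_line Q (L i)] >]]|.

(* The maximum is taken over the set of values n of busy_lines m P; these
   satisfy n <= d, so n ranges over 'I_d.+1.  An empty \max is 0. *)
Definition complexity m : nat :=
  \max_(n < d.+1 |
      `[< exists2 P, mult_dvd [set: 'I_d]%SET m P & busy_lines m P = n >]) n.

End Arrangement.

(* Main.v *)
(** Only the family [F] of the sets [S] of lines through the points of
multiplicity divisible by [m] matters.  Every [S] in [F] has at least
[#|S| - uphalf m] private lines, which lie in no other member of [F].  The lines
of [J] are chosen greedily, at the price of [m] lines used up per line chosen.
If a line [l] lies in [r >= 2] of the remaining members, choose [l] together
with [#|S| / m - 1] private lines of each of these members [S], and discard
them.  This uses up [l] and all private lines of the [r] members, which pays for
the choice because [r * uphalf m <= m * (r - 1) + 1].  When the remaining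
members are disjoint, choose [#|S| / m] private lines of one of them: all of its
[#|S|] lines are used up. *)

Require Import Defs.
From HB Require Import structures.
From mathcomp Require Import all_boot all_order all_algebra.
From mathcomp Require Import all_classical all_reals.
From mathcomp.real_closed Require Import complex.
From mathcomp Require Import zify fintype finset.

Set Implicit Arguments.
Unset Strict Implicit.
Unset Printing Implicit Defensive.

Local Open Scope set_scope.

(** * Counting in finite sets *)

Lemma exists_subset_card (T : finType) (A : {set T}) n :
  n <= #|A| -> exists2 B : {set T}, B \subset A & #|B| = n.
Proof.
move=> nA; have := cards_draws A n.
have : 0 < 'C(#|A|, n) by rewrite bin_gt0.
move=> + E; rewrite -E => /card_gt0P[B]; rewrite inE => /andP[BA /eqP Bn].
by exists B.
Qed.

Lemma exists_superset_card (T : finType) (A : {set T}) n :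
  #|A| <= n <= #|T| -> exists2 B : {set T}, A \subset B & #|B| = n.
Proof.
move=> /andP[An nT]; have CA := cardsC A.
have [|B BA Bn] := @exists_subset_card T (~: A) (n - #|A|); first by lia.
exists (A :|: B); first exact: subsetUl.
have AB0 : A :&: B = set0.
  by apply/eqP; rewrite setI_eq0 disjoint_sym -[A]setCK -subsets_disjoint.
by rewrite cardsU AB0 cards0 Bn; lia.
Qed.

Lemma leq_card_bigcup (I T : finType) (A : {set I}) (f : I -> {set T}) :
  #|\bigcup_(i in A) f i| <= \sum_(i in A) #|f i|.
Proof.
apply: (big_ind2 (fun (B : {set T}) n => #|B| <= n)) => //.
- by rewrite cards0.
- by move=> B n C p Bn Cp; rewrite (leq_trans (leq_card_setU _ _)) ?leq_add.
Qed.

(** Exchanging the two sums, each element of [D] is counted at most once. *)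
Lemma sum_card_disjoint_leq (I T : finType) (A : {set I}) (f : I -> {set T})
    (D : {set T}) :
    {in A, forall i, f i \subset D} ->
    {in A &, forall i j x, x \in f i -> x \in f j -> i = j} ->
  \sum_(i in A) #|f i| <= #|D|.
Proof.
move=> fD f_inj; under eq_bigr do rewrite -sum1_card big_mkcond /=.
rewrite exchange_big -sum1_card [leqRHS]big_mkcond /=.
apply: leq_sum => x _; rewrite -big_mkcondr sum1_card.
case: ifPn => xD; last first.
  rewrite eq_card0 // => i; apply/negP => /andP[iA /(subsetP (fD i iA))].
  exact/negP.
apply/card_le1_eqP => i j /andP[iA xi] /andP[jA xj].
exact: f_inj xj xi.
Qed.

(** * Greedy selection in a family of finite sets *)

Section Selection.
Variables (T : finType) (m : nat) (F : {set {set T}}).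
Hypothesis m_ge3 : 3 <= m.
Hypothesis F_dvd : {in F, forall S : {set T}, m %| #|S|}.
Hypothesis F_gt0 : {in F, forall S : {set T}, 0 < #|S|}.

Definition shared (S : {set T}) : {set T} :=
  [set x in S | [exists S' in F, (S' != S) && (x \in S')]].

Hypothesis F_shared : {in F, forall S, #|shared S| <= uphalf m}.

Definition private S := S :\: shared S.

Lemma private_inj S S' x :
  S' \in F -> x \in private S -> x \in S' -> S' = S.
Proof.
move=> S'F; rewrite !inE negb_and => /andP[+ xS] xS'; rewrite xS /= => H.
apply/eqP; apply: contraNT H => nS; apply/existsP; exists S'.
by rewrite S'F nS.
Qed.

Lemma card_private S : S \in F -> #|S| <= #|private S| + uphalf m.
Proof.
move=> SF; have := F_shared SF; rewrite -(cardsID (shared S) S) addnC leq_add2l.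
by apply: leq_trans; apply: subset_leq_card; apply: subsetIr.
Qed.

(** If [#|S| = k * m] with [k > 0], at least [k * m - uphalf m] elements are private, and this is at
    least [k] because [uphalf m <= m - 1]. *)
Lemma exists_private_subset S n :
  S \in F -> n * m <= #|S| ->
  exists2 B : {set T}, B \subset private S & #|B| = n.
Proof.
move=> SF nS; apply: exists_subset_card.
have := card_private SF; have := F_gt0 SF.
have /dvdnP[k Sk] := F_dvd SF.
rewrite Sk in nS *; move: nS; rewrite leq_pmul2r; last by lia.
move=> nk; rewrite muln_gt0 => /andP[k0 _]; nia.
Qed.

(** [A] collects the members settled in this step and [X] the elements chosen for them. Only
    elements lying in no member of [G :\: A] pay for [X], so the costs of successive steps add
    up. *)
Lemma greedy_step (G : {set {set T}}) : G \subset F -> G != set0 ->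
  exists (A : {set {set T}}) (X : {set T}), [/\ A \subset G, A != set0,
    m * #|X| <= #|cover G :\: cover (G :\: A)|
    & {in A, forall S : {set T}, #|S| <= m * #|X :&: S|}].
Proof.
move=> GF /set0Pn[S0 S0G].
have [/existsP[x /andP[xS0 /existsP[S1 /and3P[S1G S10 xS1]]]]|dis] :=
  boolP [exists x in S0, [exists S1 in G, (S1 != S0) && (x \in S1)]];
  last first.
  (* Here [S0] meets no other member of [G], so all its elements are used up. *)
  have S0F := subsetP GF _ S0G.
  have [|B BS0 Bn] := @exists_private_subset S0 (#|S0| %/ m) S0F.
    by rewrite divnK // F_dvd.
  have mB : m * #|B| = #|S0| by rewrite Bn mulnC divnK // F_dvd.
  have BS : B \subset S0 by rewrite (subset_trans BS0) ?subsetDl.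
  exists [set S0], B; split.
  - by rewrite sub1set.
  - by apply/set0Pn; exists S0; rewrite inE.
  - rewrite mB; apply/subset_leq_card/subsetP => x xS0; rewrite inE.
    rewrite [X in _ && X](_ : _ = true) ?andbT; last first.
      by apply/bigcupP; exists S0.
    apply: contra dis => /bigcupP[S1]; rewrite !inE => /andP[S10 S1G] xS1.
    apply/existsP; exists x; rewrite xS0; apply/existsP.
    by exists S1; apply/and3P.
  - by move=> S; rewrite inE => /eqP->; rewrite (setIidPl BS) mB.
pose A := [set S in G | x \in S].
have AG : A \subset G by apply/subsetP => S; rewrite inE => /andP[].
have AF := subset_trans AG GF.
have S0A : S0 \in A by rewrite inE S0G.
have S1A : S1 \in A by rewrite inE S1G.
have A2 : 1 < #|A| by apply/card_gt1P; exists S1, S0.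
have xA S : S \in A -> x \in S by rewrite inE => /andP[].
have xprivate S : S \in A -> x \notin private S.
  move=> SA; apply/negP => xp.
  have E S' : S' \in A -> S' = S.
    by move=> S'A; apply: private_inj xp (xA _ S'A); apply: (subsetP AF).
  by move: S10; rewrite (E _ S0A) (E _ S1A) eqxx.
(* One element fewer than [#|S| %/ m] suffices, since [x] serves every member of [A]; [set0] is a
   default value outside [A]. *)
have cP S : exists B : {set T}, S \in A ->
    B \subset private S /\ m * #|B|.+1 = #|S|.
  have [SA|_] := boolP (S \in A); last by exists set0.
  have SF := subsetP AF _ SA; have /dvdnP[k Sk] := F_dvd SF.
  have := F_gt0 SF; rewrite Sk muln_gt0 => /andP[k0 _].
  have [|B BS Bn] := @exists_private_subset S k.-1 SF; first by rewrite Sk; nia.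
  by exists B => _; split=> //; rewrite Bn prednK // mulnC.
have {cP} [c cP] := choice cP.
exists A, (x |: \bigcup_(S in A) c S); split=> //.
- by apply/set0Pn; exists S0.
- have cX : #|x |: \bigcup_(S in A) c S| <= 1 + \sum_(S in A) #|c S|.
    rewrite (leq_trans (leq_card_setU _ _)) // cards1 leq_add2l.
    exact: leq_card_bigcup.
  (* The private parts are disjoint and avoid [x], which leaves [x] as one more element to pay
     with. *)
  have cD : \sum_(S in A) #|private S| <=
      #|(cover G :\: cover (G :\: A)) :\ x|.
    apply: sum_card_disjoint_leq => [S SA|S S' SA S'A y yS]; last first.
      move=> yS'; apply: private_inj yS' (subsetP (subsetDl _ _) _ yS).
      exact: (subsetP AF).
    apply/subsetP => y yS; rewrite in_setD1.
    rewrite (contraTneq _ yS) => [|->]; last exact: xprivate.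
    rewrite /= inE andbC; apply/andP; split.
      apply/bigcupP; exists S; first exact: (subsetP AG).
      exact: subsetP (subsetDl _ _) _ yS.
    apply/negP => /bigcupP[S']; rewrite inE => /andP[S'A S'G] yS'.
    have E := private_inj (subsetP GF _ S'G) yS yS'.
    by rewrite E SA in S'A.
  have xD : x \in cover G :\: cover (G :\: A).
    rewrite inE andbC; apply/andP; split; first by apply/bigcupP; exists S0.
    apply/negP => /bigcupP[S]; rewrite !inE => /andP[+ SG].
    by rewrite SG => /negP.
  rewrite (cardsD1 x (cover G :\: _)) xD.
  have Sc : \sum_(S in A) #|S| = m * \sum_(S in A) #|c S| + m * #|A|.
    rewrite -sum1_card -mulnDr -big_split big_distrr /=.
    by apply: eq_bigr => S /cP[_ <-]; rewrite addn1.
  have Sp : \sum_(S in A) #|S| <= \sum_(S in A) #|private S| + uphalf m * #|A|.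
    rewrite -sum1_card big_distrr -big_split /=; apply: leq_sum => S SA.
    by rewrite muln1 card_private // (subsetP AF).
  (* From [#|A| >= 2] and [2 * uphalf m <= m + 1]: [#|A| * (m - uphalf m) >= m - 1]. *)
  have : #|A| * uphalf m + m <= 1 + m * #|A|.
    have : uphalf m <= m /\ (uphalf m).*2 <= m.+1 by lia.
    by move: (uphalf m) => u [um u2]; nia.
  nia.
- move=> S SA; have [cS <-] := cP S SA; rewrite leq_mul2l; apply/orP; right.
  (* As [x] is not private, it adds the missing element to [c S]. *)
  have xc : x \notin c S by apply: contra (subsetP cS x) (xprivate S SA).
  rewrite -[leqLHS]add1n -[1]/(nat_of_bool true) -xc -cardsU1.
  apply/subset_leq_card/subsetP => y; rewrite !inE => /predU1P[->|yc].
    by rewrite eqxx (xA S SA).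
  rewrite [y \in S](subsetP (subset_trans cS (subsetDl _ _)) _ yc) andbT.
  by apply/orP; right; apply/bigcupP; exists S.
Qed.

Lemma greedy_selection (G : {set {set T}}) : G \subset F ->
  exists2 J : {set T}, m * #|J| <= #|cover G| &
    {in G, forall S : {set T}, #|S| <= m * #|J :&: S|}.
Proof.
have [n] := ubnP #|G|; elim: n G => // n IHn G Gn GF.
have [->|G0] := eqVneq G set0.
  by exists set0 => [|S]; rewrite ?cards0 ?muln0 ?inE.
have [A [X [AG A0 mX XA]]] := greedy_step GF G0.
have AG' : #|G :\: A| < n.
  rewrite -card_gt0 in A0; have := subset_leq_card AG.
  by rewrite cardsDS //; lia.
have [|J mJ JG] := IHn _ AG'; first exact: subset_trans (subsetDl _ _) GF.
exists (J :|: X) => [|S SG].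
  have GA : cover (G :\: A) \subset cover G.
    by apply/bigcupsP => S; rewrite inE => /andP[_]; apply: bigcup_sup.
  (* [cover G] splits into what the remaining members cover, paying for [J], and what this step uses
     up, paying for [X]. *)
  rewrite -(subnKC (subset_leq_card GA)) -cardsDS //.
  apply: leq_trans (leq_add mJ mX).
  by rewrite -mulnDr leq_mul2l leq_card_setU orbT.
have [SA|SA] := boolP (S \in A).
  apply: leq_trans (XA S SA) _; rewrite leq_mul2l subset_leq_card ?orbT //.
  by rewrite setSI // subsetUr.
apply: leq_trans (JG S _) _; first by rewrite inE SA SG.
by rewrite leq_mul2l subset_leq_card ?orbT // setSI // subsetUl.
Qed.

End Selection.

Local Open Scope ring_scope.
Local Open Scope classical_set_scope.

(** * Pencils of lines through the points of an arrangement *)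

Section Pencils.
Variables (K : fieldType) (d : nat) (L : 'I_d -> proj_line K).

Definition pencil (P : proj_point K) : {set 'I_d} :=
  [set i | on_line P (L i)]%SET.

Lemma mult_pencil (J : {set 'I_d}) P : mult L J P = #|(J :&: pencil P)%SET|.
Proof. by apply: eq_card => i; rewrite !inE. Qed.

Lemma lines_unionP (J : {set 'I_d}) P :
  lines_union L J P <-> (0 < mult L J P)%N.
Proof.
split=> [[i iJ Pi]|/card_gt0P[i /andP[iJ Pi]]]; last by exists i.
by apply/card_gt0P; exists i; rewrite inE iJ.
Qed.

Definition pencils m : {set {set 'I_d}} :=
  [set S | `[< exists2 P, mult_dvd L [set: 'I_d]%SET m P & S = pencil P >]]%SET.

(** Distinct pencils come from distinct points, so a shared line of the pencil of [P] is counted by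
    [busy_lines L m P]. *)
Lemma card_shared_pencil m S : S \in pencils m ->
  (#|shared (pencils m) S| <= complexity L m)%N.
Proof.
rewrite inE => /asboolP[P Pm ->].
have Pd : (busy_lines L m P < d.+1)%N.
  by rewrite ltnS -[leqRHS]card_ord max_card.
apply: (@leq_trans (busy_lines L m P)).
  apply/subset_leq_card/subsetP => i; rewrite !inE => /andP[-> /existsP[S']].
  rewrite inE => /and3P[/asboolP[Q Qm ->] QP]; rewrite inE => iQ.
  by apply/asboolP; exists Q; split=> //; apply: contraNneq QP => ->.
rewrite /complexity (bigD1 (Ordinal Pd)) /=; first exact: leq_maxl.
by apply/asboolP; exists P.
Qed.

End Pencils.

Theorem theorem2 (R : realType) (m d : nat) (L : 'I_d -> proj_line R[i])
    (m_ge3 : (3 <= m)%N) (L_inj : injective L) (m_dvd_d : (m %| d)%N)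
    (complexity_le : (complexity L m <= uphalf m)%N) :
  exists J : {set 'I_d}, #|J| = (d %/ m)%N /\
    forall k : nat, (1 <= k)%N ->
      mult_ge L [set: 'I_d]%SET 3 `&` mult_eq L [set: 'I_d]%SET (k * m)
        `<=` mult_ge L J k.
Proof.
have m_gt0 : (0 < m)%N by lia.
have F_dvd : {in pencils L m, forall S : {set 'I_d}, m %| #|S|}%N.
  by move=> S; rewrite inE => /asboolP[P [_ +] ->]; rewrite mult_pencil setTI.
have F_gt0 : {in pencils L m, forall S : {set 'I_d}, 0 < #|S|}%N.
  move=> S; rewrite inE => /asboolP[P [/lines_unionP + _] ->].
  by rewrite mult_pencil setTI.
have F_shared : {in pencils L m, forall S : {set 'I_d},
    #|shared (pencils L m) S| <= uphalf m}%N.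
  by move=> S SF; apply: leq_trans complexity_le; apply: card_shared_pencil.
have [J0 mJ0 J0P] := greedy_selection m_ge3 F_dvd F_gt0 F_shared (subxx _).
have dm : (d %/ m <= d)%N by apply: leq_div.
(* [J0] has at most [d %/ m] lines; adding further lines only raises multiplicities. *)
have [|J J0J Jd] := @exists_superset_card _ J0 (d %/ m).
  rewrite card_ord dm andbT leq_divRL // mulnC (leq_trans mJ0) //.
  by rewrite -[leqRHS]card_ord max_card.
exists J; split=> // k k1 P [_ [TP PE]].
have kJ : (k <= mult L J P)%N.
  have PF : pencil L P \in pencils L m.
    rewrite inE; apply/asboolP; exists P => //.
    by split; rewrite ?PE ?dvdn_mull.
  (* The pencil has [k * m] lines, so the selection bound, divided by [m], gives [k] lines of [J0]
     through [P]. *)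
  move: (J0P _ PF) PE; rewrite !mult_pencil setTI => /[swap] ->.
  rewrite mulnC leq_pmul2l // => /leq_trans; apply.
  by rewrite subset_leq_card // setSI.
by split=> //; apply/lines_unionP; apply: leq_trans kJ.
Qed.
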